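(* Let $T$ be a (nondegenerate) triangle in the plane $\mathbb{R}^2$. Then $T$ has a taxicab circumcircle if and only if $T$ is an inscribed triangle.
   Context: The plane $\mathbb{R}^2$ carries the taxicab metric $d((x_1,y_1),(x_2,y_2)) = |x_1-x_2|+|y_1-y_2|$. A taxicab circle with center $c$ and radius $r>0$ is the set $\{p : d(p,c)=r\}$ (a square with sides of slope $1$ and $-1$). A taxicab circumcircle of a triangle is a taxicab circle that passes through all three vertices of the triangle. The angle of a triangle at a vertex $V$ is the convex region bounded by the two rays from $V$ along the two sides meeting at $V$. A line through $V$ remains outside the angle if it does not meet the open interior of this region (it may contain one of the bounding rays). The angle is positively inscribed if the line of slope $1$ through its vertex remains outside the angle; negatively inscribed if the line of slope $-1$ through its vertex remains outside the angle; and inscribed if it is positively inscribed, negatively inscribed, or both. A triangle is inscribed if all three of its angles are inscribed. *)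

(* Defs.v *)
From HB Require Import structures.
From mathcomp Require Import all_boot all_order all_algebra.
From mathcomp Require Import all_classical all_reals all_analysis.

Set Implicit Arguments.
Unset Strict Implicit.
Unset Printing Implicit Defensive.

Import Order.TTheory GRing.Theory Num.Theory.
Import numFieldNormedType.Exports.

Local Open Scope classical_set_scope.
Local Open Scope ring_scope.

Definition taxicab (R : realType) (p q : R * R) : R :=
  `|p.1 - q.1| + `|p.2 - q.2|.

Definition taxicab_circle (R : realType) (c : R * R) (r : R) : set (R * R) :=
  [set p | taxicab p c = r].

Definition has_taxicab_circumcircle (R : realType) (A B C : R * R) : Prop :=
  exists (c : R * R) (r : R),
    0 < r /\ [set A; B; C] `<=` taxicab_circle c r.

Definition line (R : realType) (p v : R * R) : set (R * R) :=
  [set p + t *: v | t in [set: R]].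

Definition collinear (R : realType) (A B C : R * R) : Prop :=
  exists p v : R * R, v != 0 /\ [set A; B; C] `<=` line p v.

Definition slope_line (R : realType) (m : R) (V : R * R) : set (R * R) :=
  line V (1, m).

(* For V, A, B not collinear, the convex region bounded by the rays from V
   through A and from V through B, boundary included. *)
Definition angle (R : realType) (V A B : R * R) : set (R * R) :=
  [set p | exists s t : R,
     [/\ 0 <= s, 0 <= t & p = V + s *: (A - V) + t *: (B - V)]].

Definition outside_angle (R : realType) (l : set (R * R)) (V A B : R * R) :
    Prop :=
  l `&` interior (angle V A B) = set0.

Definition positively_inscribed (R : realType) (V A B : R * R) : Prop :=
  outside_angle (slope_line 1 V) V A B.

Definition negatively_inscribed (R : realType) (V A B : R * R) : Prop :=
  outside_angle (slope_line (- 1) V) V A B.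

Definition inscribed_angle (R : realType) (V A B : R * R) : Prop :=
  positively_inscribed V A B \/ negatively_inscribed V A B.

Definition inscribed_triangle (R : realType) (A B C : R * R) : Prop :=
  [/\ inscribed_angle A B C, inscribed_angle B C A & inscribed_angle C A B].

(* Main.v *)
Require Import Defs.
From mathcomp Require Import all_boot all_order all_algebra.
From mathcomp Require Import all_classical all_reals all_analysis.
From mathcomp Require Import ring lra.

(** The coordinates [u = y - x] and [w = y + x] turn the taxicab metric into
    the sup metric, whose circles are the axis-parallel squares, and turn the
    lines of slope [1] and [-1] into the level lines of [u] and [w].  A level
    line of a linear form through a vertex [V] avoids the open angle at [V]
    exactly when the form does not change sign between the two sides at [V]
    ([outside_angle_slope]).  So the angle at [V] is inscribed exactly when [u]
    or [w] takes at [V] a value that is not strictly between its values at the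
    other two vertices ([inscribed_angleE]).

    If the vertices lie on a square, each of them maximizes or minimizes [u] or
    [w] over the whole square, hence over the triangle
    ([extremal_on_square]).

    Conversely, let [L] and [N] be the two vertices at the largest sup distance
    [D], and suppose that this distance is a difference of [u]-coordinates.  A
    square of side [D] between the level lines of [u] through [L] and [N] has
    [L] and [N] on its opposite sides provided that its [w]-range contains
    their [w]-coordinates, and this range can still slide.  The remaining vertex
    [M] is then reached either because it is also on one of the two level lines,
    or, when it is extremal for [w], by sliding the square until a side parallel
    to the [u]-axis passes through [M] ([circumsquare_of_width]). *)

Set Implicit Arguments.
Unset Strict Implicit.
Unset Printing Implicit Defensive.

Import Order.TTheory GRing.Theory Num.Theory.
Import numFieldNormedType.Exports.

Local Open Scope classical_set_scope.
Local Open Scope ring_scope.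

(** * Level lines and angles *)

Section Angles.
Variable R : realType.
Implicit Types (m : R) (p q V A B C : R * R).

Definition intercept m p : R := p.2 - m * p.1.

Definition not_strictly_between (a b v : R) : Prop :=
  (v <= a /\ v <= b) \/ (a <= v /\ b <= v).

Lemma strictly_betweenP (a b v : R) :
  ~ not_strictly_between a b v -> (a < v < b) \/ (b < v < a).
Proof.
rewrite /not_strictly_between.
case: (ltgtP a v) => av; case: (ltgtP b v) => bv nb; try by (left + right).
all: by case: nb; (left + right); split; rewrite ?av ?bv ?lexx // ltW.
Qed.

Definition det p q : R := p.1 * q.2 - p.2 * q.1.

Lemma pair_eq p q : p.1 = q.1 -> p.2 = q.2 -> p = q.
Proof. by case: p q => [p1 p2] [q1 q2] /= -> ->. Qed.

(** Simplification would leave [*:] between real numbers, which the arithmetic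
    tactics do not read as a product. *)
Lemma coordE : (forall p q, ((p + q).1 = p.1 + q.1) * ((p + q).2 = p.2 + q.2)) *
  (forall p, ((- p).1 = - p.1) * ((- p).2 = - p.2)) *
  (forall (k : R) p, ((k *: p).1 = k * p.1) * ((k *: p).2 = k * p.2)).
Proof. by []. Qed.

Lemma collinear_rot A B C : collinear A B C -> collinear B C A.
Proof.
move=> [p [v [v0 sub]]]; exists p, v; split=> // q.
by case=> [[->|->]|->]; apply: sub; [left; right|right|left; left].
Qed.

Lemma collinear_dup V A : collinear V V A.
Proof.
have [->|AV] := eqVneq A V.
  exists V, (1, 0); split; first by rewrite xpair_eqE oner_eq0.
  by move=> _ [[->|->]|->]; exists 0; rewrite ?scale0r ?addr0.
exists V, (A - V); split; first by rewrite subr_eq0.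
move=> _ [[->|->]|->]; [exists 0 => //|exists 0 => //|exists 1 => //].
- by rewrite scale0r addr0.
- by rewrite scale0r addr0.
- by rewrite scale1r subrKC.
Qed.

Lemma det_neq0 V A B : ~ collinear V A B -> det (A - V) (B - V) != 0.
Proof.
move=> nc; apply/negP => /eqP; rewrite /det /= => d0.
apply: nc.
have [->|AV] := eqVneq A V; first exact: collinear_dup.
exists V, (A - V); split; first by rewrite subr_eq0.
move=> _ [[->|->]|->]; [by exists 0 => //; rewrite scale0r addr0
                       |by exists 1 => //; rewrite scale1r subrKC|].
(* One coordinate of [A - V] is nonzero, and it gives the ratio of [B - V] to
   [A - V]. *)
have [A1|A1] := eqVneq (A.1 - V.1) 0.
  have A2 : A.2 - V.2 != 0.
    by apply: contra AV => /eqP A2; apply/eqP; apply: pair_eq; apply: subr0_eq.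
  exists ((B.2 - V.2) / (A.2 - V.2)) => //.
  have B1 : B.1 - V.1 = 0.
    by move: d0; rewrite A1 mul0r sub0r => /eqP;
      rewrite oppr_eq0 mulf_eq0 (negPf A2) => /eqP.
  apply: pair_eq; rewrite !coordE; last by field.
  by rewrite A1 mulr0 addr0 -(subr0_eq B1).
exists ((B.1 - V.1) / (A.1 - V.1)) => //.
apply: pair_eq; rewrite !coordE; first by field.
have -> : B.2 = V.2 + (A.1 - V.1) * (B.2 - V.2) / (A.1 - V.1) by field.
by rewrite (subr0_eq d0); field.
Qed.

Lemma open_halfplane (a b c : R) : open [set p : R * R | c < a * p.1 + b * p.2].
Proof.
have cf : continuous (fun p : R * R => a * p.1 + b * p.2).
  move=> p; apply: cvgD; apply: cvgM.
  - exact: cvg_cst.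
  - exact: cvg_fst.
  - exact: cvg_cst.
  - exact: cvg_snd.
have -> : [set p : R * R | c < a * p.1 + b * p.2] =
  (fun p => a * p.1 + b * p.2) @^-1` [set x | c < x] by [].
apply: open_comp; last exact: open_gt.
by move=> p _; exact: cf.
Qed.

(** By Cramer's rule the coefficients on the two sides of the angle are affine
    functions, so that both stay positive near the given point. *)
Lemma interior_angle V A B (s t : R) : det (A - V) (B - V) != 0 ->
  0 < s -> 0 < t -> interior (angle V A B) (V + s *: (A - V) + t *: (B - V)).
Proof.
move=> d0 s0 t0.
set a := A - V in d0 *; set b := B - V in d0 *; set d := det a b in d0 *.
pose S := [set p : R * R |
  (b.2 / d) * V.1 - (b.1 / d) * V.2 < (b.2 / d) * p.1 + (- (b.1 / d)) * p.2] `&`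
  [set p : R * R |
  (a.1 / d) * V.2 - (a.2 / d) * V.1 < (- (a.2 / d)) * p.1 + (a.1 / d) * p.2].
have oS : open S by apply: openI; exact: open_halfplane.
have SA : S `<=` angle V A B.
  move=> p [/= p1 p2].
  exists (det (p - V) b / d), (det a (p - V) / d); split.
  - have -> : det (p - V) b / d = b.2 / d * p.1 + (- (b.1 / d)) * p.2 -
        (b.2 / d * V.1 - b.1 / d * V.2) by rewrite /det !coordE; field.
    by rewrite subr_ge0 ltW.
  - have -> : det a (p - V) / d = (- (a.2 / d)) * p.1 + a.1 / d * p.2 -
        (a.1 / d * V.2 - a.2 / d * V.1) by rewrite /det !coordE; field.
    by rewrite subr_ge0 ltW.
  - by apply: pair_eq; move: d0; rewrite /d /det /a /b !coordE => d0; field.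
move: SA; rewrite open_subsetE //; apply; split; rewrite /mkset -subr_gt0.
- set x := (X in 0 < X); suff -> : x = s by [].
  by rewrite /x; move: d0; rewrite /d /det /a /b !coordE => d0; field.
- set x := (X in 0 < X); suff -> : x = t by [].
  by rewrite /x; move: d0; rewrite /d /det /a /b !coordE => d0; field.
Qed.

(** A small vertical move of an interior point stays in the set and changes the
    intercept by the same amount. *)
Lemma interior_intercept m (S : set (R * R)) p : interior S p ->
  exists q1 q2, [/\ S q1, S q2, intercept m q1 < intercept m p
                             & intercept m p < intercept m q2].
Proof.
move=> /nbhs_ballP [e /= e0 eS].
exists (p.1, p.2 - e / 2), (p.1, p.2 + e / 2); rewrite /intercept /=; split.
- apply: eS; split => /=; rewrite /ball /= ?subrr ?normr0 //.
  by rewrite opprB addrC subrK gtr0_norm; lra.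
- apply: eS; split => /=; rewrite /ball /= ?subrr ?normr0 //.
  by rewrite opprD addNKr normrN gtr0_norm; lra.
- lra.
- lra.
Qed.

(** If the intercept at [V] is strictly between those at [A] and [B], then the
    level line of [V] crosses the open segment from [A] to [B], so it meets the
    open angle.  Otherwise [V] is extremal for the intercept over the
    whole angle, and a linear form has no extremum at an interior point. *)
Lemma outside_angle_slope m V A B : ~ collinear V A B ->
  outside_angle (slope_line m V) V A B <->
  not_strictly_between (intercept m A) (intercept m B) (intercept m V).
Proof.
move=> /det_neq0 d0; split.
  move=> out; apply: contrapT => /strictly_betweenP between.
  (* The intercepts at [A] and [B] weighted by their distances to the one at
     [V], in exchanged order, balance out on the level line through [V]. *)
  have [s [t [s0 t0 balance]]] : exists s t : R, [/\ 0 < s, 0 < t &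
      s * (intercept m A - intercept m V) +
      t * (intercept m B - intercept m V) = 0].
    case: between => /andP[lt1 lt2].
      exists (intercept m B - intercept m V), (intercept m V - intercept m A).
      by split; rewrite ?subr_gt0 //; ring.
    exists (intercept m V - intercept m B), (intercept m A - intercept m V).
    by split; rewrite ?subr_gt0 //; ring.
  have intq := interior_angle d0 s0 t0.
  move/seteqP: out => [/(_ (V + s *: (A - V) + t *: (B - V))) out _].
  apply: out; split => //.
  exists (s * (A.1 - V.1) + t * (B.1 - V.1)) => //.
  apply: pair_eq; rewrite !coordE /=; first by ring.
  apply/eqP; rewrite -subr_eq0 -oppr_eq0; apply/eqP.
  by rewrite -[RHS]balance /intercept; ring.
move=> ext; apply/seteqP; split => // p [[k _ <-]].
move=> /(interior_intercept m) [q1 [q2 [[s1 [t1 [s10 t10 ->]]]]]].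
move=> [s2 [t2 [s20 t20 ->]]].
have kV : intercept m (V + k *: (1, m)) = intercept m V.
  by rewrite /intercept !coordE /=; ring.
have interceptE s t : intercept m (V + s *: (A - V) + t *: (B - V)) =
    intercept m V + (s * (intercept m A - intercept m V) +
                     t * (intercept m B - intercept m V)).
  by rewrite /intercept !coordE; ring.
rewrite !interceptE kV gtrDl ltrDl => lt1 lt2.
case: ext => -[geA geB].
  by move: lt1; rewrite ltNge addr_ge0 // mulr_ge0 // subr_ge0.
have sA : s2 * (intercept m A - intercept m V) <= 0.
  by rewrite mulr_ge0_le0 // subr_le0.
have tB : t2 * (intercept m B - intercept m V) <= 0.
  by rewrite mulr_ge0_le0 // subr_le0.
by move: lt2; rewrite ltNge -[leRHS]addr0 lerD.
Qed.

End Angles.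

(** * Taxicab circles as squares *)

Section Squares.
Variable R : realType.
Implicit Types (p q c P Q S L M N : R * R).

Definition skew p : R * R := (intercept 1 p, intercept (- 1) p).

(** This is [`|x| + `|y| = max `|y - x| `|y + x|]; the norm of the product
    [R * R] is the sup norm. *)
Lemma taxicab_skew p c : taxicab p c = `|skew p - skew c|.
Proof.
rewrite prod_normE /taxicab /skew /intercept !coordE /=.
set x := p.1 - c.1; set y := p.2 - c.2.
have -> : p.2 - 1 * p.1 - (c.2 - 1 * c.1) = y - x by rewrite /x /y; ring.
have -> : p.2 - (- 1) * p.1 - (c.2 - (- 1) * c.1) = y + x by rewrite /x /y; ring.
clearbody x y.
by case: (ger0P x) => ?; case: (ger0P y) => ?; case: (ger0P (y - x)) => ?;
  case: (ger0P (y + x)) => ?; rewrite maxEle; case: ifPn;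
  rewrite -?ltNge => ?; lra.
Qed.

Lemma skew_surj q : exists p, skew p = q.
Proof.
exists ((q.2 - q.1) / 2, (q.1 + q.2) / 2).
by apply: pair_eq; rewrite /skew /intercept /=; field.
Qed.

Lemma skew_inj : injective skew.
Proof.
move=> p q; rewrite /skew /intercept => -[e1 e2].
by apply: pair_eq; lra.
Qed.

Definition has_circumsquare P Q S : Prop :=
  exists c (r : R), 0 < r /\ [/\ `|P - c| = r, `|Q - c| = r & `|S - c| = r].

Lemma taxicab_circumcircleE P Q S : has_taxicab_circumcircle P Q S <->
  has_circumsquare (skew P) (skew Q) (skew S).
Proof.
split=> [[c [r [r0 sub]]]|[c [r [r0 [eP eQ eS]]]]].
  exists (skew c), r; split=> //; split; rewrite -taxicab_skew; apply: sub.
  - by left; left.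
  - by left; right.
  - by right.
have [c' c'E] := skew_surj c.
exists c', r; split=> // p.
by case=> [[->|->]|->]; rewrite /taxicab_circle /mkset taxicab_skew c'E.
Qed.

Definition extremal_coordinate P Q p : Prop :=
  not_strictly_between P.1 Q.1 p.1 \/ not_strictly_between P.2 Q.2 p.2.

Lemma inscribed_angleE V P Q : ~ collinear V P Q ->
  inscribed_angle V P Q <-> extremal_coordinate (skew P) (skew Q) (skew V).
Proof.
move=> nc; rewrite /inscribed_angle /positively_inscribed.
by rewrite /negatively_inscribed !outside_angle_slope.
Qed.

Lemma sup_norm_le p (r : R) : `|p| <= r -> - r <= p.1 <= r /\ - r <= p.2 <= r.
Proof. by rewrite prod_normE ge_max -!ler_norml => /andP[]. Qed.

(** A point of the boundary of a square realizes the maximum or the minimum of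
    one of the coordinates over the whole square. *)
Lemma extremal_on_square c (r : R) P Q p :
  `|P - c| = r -> `|Q - c| = r -> `|p - c| = r -> extremal_coordinate P Q p.
Proof.
move=> eP eQ.
have /sup_norm_le[] : `|P - c| <= r by rewrite eP.
have /sup_norm_le[] : `|Q - c| <= r by rewrite eQ.
rewrite !coordE => /andP[? ?] /andP[? ?] /andP[? ?] /andP[? ?].
rewrite prod_normE !coordE maxEle /extremal_coordinate /not_strictly_between.
case: ifP => _; [set x := _ - _|set x := _ - _] => ex; [right|left];
  by case: (ger0P x) ex => _ ex; rewrite /x in ex; [right|left]; split; lra.
Qed.

(** All squares considered have center abscissa [(L.1 + N.1) / 2] and half-side
    [r = (N.1 - L.1) / 2], so that [L] and [N] lie on the lines carrying their
    vertical sides; only the center ordinate is to be chosen.  If [M] is the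
    lowest or the highest point, a horizontal side is put through [M], and [L]
    and [N] are in range because no vertical distance exceeds the side [2 r].
    If [M] is strictly between [L] and [N] vertically, it must be on one of the
    vertical lines, and any square whose vertical range contains [L] and [N]
    will do. *)
Lemma circumsquare_of_width L M N : L.1 < N.1 ->
  `|L - M| <= N.1 - L.1 -> `|M - N| <= N.1 - L.1 -> `|L - N| <= N.1 - L.1 ->
  extremal_coordinate L N M -> has_circumsquare L M N.
Proof.
move=> ltLN /sup_norm_le[] + + /sup_norm_le[] + + /sup_norm_le[] _.
rewrite !coordE => /andP[? ?] /andP[? ?] /andP[? ?] /andP[? ?] /andP[? ?].
set r := (N.1 - L.1) / 2 => ext.
have r_gt0 : 0 < r by rewrite /r; lra.
have onx p (cy : R) : p.1 = L.1 \/ p.1 = N.1 -> - r <= p.2 - cy <= r ->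
    `|p - ((L.1 + N.1) / 2, cy)| = r.
  rewrite -ler_norml prod_normE !coordE /= => ep le_r.
  have -> : `|p.1 - (L.1 + N.1) / 2| = r.
    rewrite /r; case: ep => ->; first by rewrite ltr0_norm; lra.
    by rewrite gtr0_norm; lra.
  by rewrite max_l.
have ony p (cy : R) : - r <= p.1 - (L.1 + N.1) / 2 <= r -> `|p.2 - cy| = r ->
    `|p - ((L.1 + N.1) / 2, cy)| = r.
  by rewrite -ler_norml prod_normE !coordE /= => le_r er; rewrite max_r ?er.
have slide (cy : R) : - r <= L.2 - cy <= r -> - r <= N.2 - cy <= r ->
    `|M.2 - cy| = r -> has_circumsquare L M N.
  move=> Lcy Ncy Mcy; exists ((L.1 + N.1) / 2, cy), r; split=> //; split.
  - by apply: onx => //; left.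
  - by apply: ony => //; rewrite /r; apply/andP; split; lra.
  - by apply: onx => //; right.
have [[[? ?]|[? ?]]|/strictly_betweenP between] :=
    EM (not_strictly_between L.2 N.2 M.2).
- have er : `|M.2 - (M.2 + r)| = r by rewrite distrC addrC addKr gtr0_norm.
  by apply: slide er; apply/andP; split; rewrite /r; lra.
- have er : `|M.2 - (M.2 - r)| = r by rewrite subKr gtr0_norm.
  by apply: slide er; apply/andP; split; rewrite /r; lra.
have Mx : M.1 = L.1 \/ M.1 = N.1.
  by case: ext => -[[? ?]|[? ?]]; [left|right| |]; try lra;
    case: between => /andP[? ?]; lra.
exists ((L.1 + N.1) / 2, (L.2 + N.2) / 2), r; split=> //.
split; apply: onx; [by left| |exact: Mx| |by right| ];
  rewrite /= /r; case: between => /andP[? ?]; apply/andP; split; lra.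
Qed.

Definition swap p : R * R := (p.2, p.1).

Lemma sup_norm_swap p q : `|swap p - swap q| = `|p - q|.
Proof. by rewrite !prod_normE !coordE /= maxC. Qed.

Lemma circumsquare_swap P Q S :
  has_circumsquare (swap P) (swap Q) (swap S) -> has_circumsquare P Q S.
Proof.
move=> [c [r [r0 [eP eQ eS]]]]; exists (swap c), r.
split=> //; split; rewrite -sup_norm_swap [swap (swap c)]/swap;
  by rewrite -surjective_pairing.
Qed.

Lemma circumsquare_rev P Q S : has_circumsquare P Q S -> has_circumsquare S Q P.
Proof. by move=> [c [r [r0 [eP eQ eS]]]]; exists c, r. Qed.

Lemma circumsquare_rot P Q S : has_circumsquare P Q S -> has_circumsquare Q S P.
Proof. by move=> [c [r [r0 [eP eQ eS]]]]; exists c, r. Qed.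

Lemma extremal_coordinateC P Q p :
  extremal_coordinate P Q p -> extremal_coordinate Q P p.
Proof.
by case=> -[[? ?]|[? ?]]; [left; left|left; right|right; left|right; right].
Qed.

(** Exchanging the coordinates, and then [L] and [N], reduces to the case where
    the largest distance is [N.1 - L.1].  The endpoints of the longest side are
    extremal automatically, so that the condition bears on the third vertex. *)
Lemma circumsquare_of_diameter L M N : L != N ->
  `|L - M| <= `|L - N| -> `|M - N| <= `|L - N| ->
  extremal_coordinate L N M -> has_circumsquare L M N.
Proof.
wlog wide : L M N / `|L.1 - N.1| = `|L - N|.
  move=> IH LN LM MN ext.
  have [fst_ge|/ltW snd_ge] := leP `|L.2 - N.2| `|L.1 - N.1|.
    by apply: IH => //; rewrite prod_normE !coordE max_l.
  apply: circumsquare_swap; apply: IH; rewrite ?sup_norm_swap //.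
  - by rewrite prod_normE !coordE max_r.
  - by apply: contra LN => /eqP[e1 e2]; apply/eqP; exact: pair_eq.
  - by case: ext; [right|left].
wlog ltLN : L N wide / L.1 < N.1.
  move=> IH LN LM MN ext.
  have : 0 < `|L.1 - N.1| by rewrite wide normr_gt0 subr_eq0.
  rewrite normr_gt0 subr_eq0 => /[dup]; rewrite {1}neq_lt => /orP[lt _|lt _].
    exact: IH.
  apply: circumsquare_rev; apply: IH => //.
  - by rewrite distrC wide distrC.
  - by rewrite eq_sym.
  - by rewrite distrC [leRHS]distrC.
  - by rewrite distrC [leRHS]distrC.
  - exact: extremal_coordinateC.
have -> : `|L - N| = N.1 - L.1 by rewrite -wide distrC gtr0_norm ?subr_gt0.
move=> _ LM MN; apply: circumsquare_of_width => //.
by rewrite -wide distrC gtr0_norm ?subr_gt0.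
Qed.

End Squares.

Theorem theorem4p1 (R : realType) (A B C : R * R) (hT : ~ collinear A B C) :
  has_taxicab_circumcircle A B C <-> inscribed_triangle A B C.
Proof.
have hBCA : ~ collinear B C A by move=> /collinear_rot/collinear_rot.
have hCAB : ~ collinear C A B by move=> /collinear_rot.
rewrite taxicab_circumcircleE /inscribed_triangle.
rewrite (propext (inscribed_angleE hT)) (propext (inscribed_angleE hBCA)).
rewrite (propext (inscribed_angleE hCAB)).
split=> [[c [r [_ [eA eB eC]]]]|[extA extB extC]].
  by split; apply: extremal_on_square; eassumption.
have skew_neq (P Q S : R * R) : ~ collinear P Q S -> skew P != skew Q.
  move=> nc; apply: contra_notN nc => /eqP/skew_inj <-.
  exact: collinear_dup.
have AB := skew_neq _ _ _ hT.
have BC := skew_neq _ _ _ hBCA.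
have CA := skew_neq _ _ _ hCAB.
have opposite (P Q S : R * R) : P != Q ->
    `|Q - S| <= `|P - Q| -> `|S - P| <= `|P - Q| ->
    extremal_coordinate P Q S -> has_circumsquare P Q S.
  move=> PQ QS SP ext; apply: circumsquare_rev; apply: circumsquare_rot.
  by apply: circumsquare_of_diameter; rewrite // distrC.
(* Up to a rotation of the vertices, the longest side is [A B]. *)
have [AB_BC|/ltW BC_AB] := leP `|skew A - skew B| `|skew B - skew C|.
  have [BC_CA|/ltW CA_BC] := leP `|skew B - skew C| `|skew C - skew A|.
    apply: circumsquare_rot; apply: opposite => //.
    exact: le_trans BC_CA.
  do 2 apply: circumsquare_rot; exact: opposite.
have [AB_CA|/ltW CA_AB] := leP `|skew A - skew B| `|skew C - skew A|.
  apply: circumsquare_rot; apply: opposite => //.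
  exact: le_trans AB_CA.
exact: opposite.
Qed.
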